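(* Let $H$ be a locally finite, countably infinite graph. Then \[\rho(H)\leq f\left(\liminf_{n\to\infty}\frac{\mu(H,n)}{n}\right).\]
   Context: A graph is locally finite if every vertex has finite degree. Let $K_{\mathbb{N}}$ be the complete graph on the natural numbers $\mathbb{N}=\{1,2,\dots\}$, and $[n]=\{1,\dots,n\}$. For $S\subseteq\mathbb{N}$ the (upper) density is $\bar d(S)=\limsup_{n\to\infty}|S\cap[n]|/n$, and for a subgraph $H'\subseteq K_{\mathbb{N}}$ we set $\bar d(H')=\bar d(V(H'))$. For a countably infinite graph $H$ (vertex set of the same cardinality as $\mathbb{N}$), the Ramsey upper density $\rho(H)$ is the supremum of the values $\lambda$ for which, for every two-coloring of $E(K_{\mathbb{N}})$, there exists a monochromatic (not necessarily induced) subgraph $H'\subseteq K_{\mathbb{N}}$, isomorphic to $H$, with $\bar d(H')\geq\lambda$. For $S\subseteq V(H)$, $N(S)=\left(\bigcup_{v\in S}N(v)\right)\setminus S$ is the set of vertices outside $S$ with a neighbor in $S$. $\mu(H,n)$ is the minimum value of $|N(I)|$ over independent sets $I$ of $H$ of size $n$. The liminf is taken in $[0,+\infty]$. Definition of $f:[0,+\infty]\to\mathbb{R}$. Let $\gamma\in(-1,1)$. For a continuous $g:[0,+\infty)\to\mathbb{R}$ let $\Gamma^+_\gamma(g,t)=\min\{x:\gamma x+g(x)\geq t\}$ and $\Gamma^-_\gamma(g,t)=\min\{x:\gamma x-g(x)\geq t\}$, the minimum of the empty set being $+\infty$. Let $h(\gamma)=\inf_g\limsup_{t\to\infty}\frac{\Gamma^+_\gamma(g,t)+\Gamma^-_\gamma(g,t)}{t}$,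 the infimum being over all 1-Lipschitz functions $g:[0,+\infty)\to\mathbb{R}$ with $g(0)=0$ (1-Lipschitz: $|g(x)-g(y)|\leq|x-y|$ for all $x,y$). For $\lambda\in(0,+\infty)$ set \[f(\lambda)=1-\frac{1}{\frac{2\lambda}{(1+\lambda)^2}h\left(\frac{\lambda-1}{\lambda+1}\right)+\frac{2\lambda}{1+\lambda}},\] and $f(0)=1$, $f(+\infty)=1/2$. *)

(* Defs.v *)
From mathcomp Require Import all_boot all_order all_algebra.
From mathcomp Require Import finmap.
From mathcomp Require Import all_classical all_reals all_analysis.

Set Implicit Arguments.
Unset Strict Implicit.
Unset Printing Implicit Defensive.

Import Order.TTheory GRing.Theory Num.Theory.
Import numFieldNormedType.Exports.

Local Open Scope classical_set_scope.
Local Open Scope ring_scope.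
Local Open Scope card_scope.

(** The vertex set is an arbitrary subset of the ambient type [T], so that
    subgraphs of a graph on [T] are again graphs on [T]. *)
Record sgraph (T : Type) := SGraph {
  vert : set T ;
  adj : T -> T -> Prop ;
  adj_sym : forall u v, adj u v -> adj v u ;
  adj_irr : forall v, ~ adj v v ;
  adj_vert : forall u v, adj u v -> vert u
}.

Section Graphs.
Context {T : Type}.
Implicit Types (G H : sgraph T) (S I : set T).

Definition nbr H (v : T) : set T := [set w | adj H v w].

Definition locally_finite H := forall v, vert H v -> finite_set (nbr H v).

Definition countably_infinite H := vert H #= [set: nat].

Definition nbrs H S : set T := (\bigcup_(v in S) nbr H v) `\` S.

Definition independent H I :=
  I `<=` vert H /\ forall u v, I u -> I v -> ~ adj H u v.

Definition subgraph G H :=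
  vert G `<=` vert H /\ forall u v, adj G u v -> adj H u v.

End Graphs.

Definition isomorphic (T U : Type) (G : sgraph T) (H : sgraph U) :=
  exists phi : T -> U, set_bij (vert G) (vert H) phi /\
    forall u v, vert G u -> vert G v -> (adj G u v <-> adj H (phi u) (phi v)).

(** The complete graph on the positive natural numbers. *)
Definition KN : sgraph nat.
Proof.
refine (@SGraph nat [set n | (0 < n)%N]
          (fun m n => [/\ (0 < m)%N, (0 < n)%N & m != n]) _ _ _).
- by move=> m n [m0 n0 mn]; split=> //; rewrite eq_sym.
- by move=> n [_ _]; rewrite eqxx.
- by move=> m n [].
Defined.

(** A two-coloring of the edges of [KN] is a symmetric [c : nat -> nat -> bool];
    its values on pairs which are not edges are irrelevant. *)
Definition monochromatic (c : nat -> nat -> bool) (G : sgraph nat) :=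
  exists b : bool, forall u v, adj G u v -> c u v = b.

Section Densities.
Variable R : realType.
Local Open Scope ereal_scope.

Definition upper_density (S : set nat) : \bar R :=
  limn_esup (fun n =>
    (#|` fset_set (S `&` [set k | (1 <= k <= n)%N])|%:R / n%:R)%:E).

Definition ramsey_upper_density (T : Type) (H : sgraph T) : \bar R :=
  ereal_sup [set l%:E | l in [set l : R |
    forall c : nat -> nat -> bool, symmetric c ->
      exists G : sgraph nat, [/\ subgraph G KN, isomorphic H G,
        monochromatic c G & l%:E <= upper_density (vert G)]]].

(** An infimum of a set of natural numbers, hence a minimum whenever [H] has an
    independent set of size [n] with finitely many outside neighbors. *)
Definition mu (T : Type) (H : sgraph T) (n : nat) : \bar R :=
  ereal_inf [set m%:R%:E | m in [set m : nat |
    exists I : set T, [/\ independent H I, I #= `I_n & nbrs H I #= `I_m]]].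

(** Functions on [[0, +oo)] are represented by functions on [R], of which only
    the values on nonnegative reals are used. For continuous [g] the infima
    below are attained as soon as the set is nonempty, and they are [+oo] on
    the empty set. *)
Definition Gamma_plus (gamma : R) (g : R -> R) (t : R) : \bar R :=
  ereal_inf [set x%:E | x in [set x : R | 0 <= x /\ t <= gamma * x + g x]%R].

Definition Gamma_minus (gamma : R) (g : R -> R) (t : R) : \bar R :=
  ereal_inf [set x%:E | x in [set x : R | 0 <= x /\ t <= gamma * x - g x]%R].

Definition h (gamma : R) : \bar R :=
  ereal_inf [set
    limf_esup (fun t : R =>
      (Gamma_plus gamma g t + Gamma_minus gamma g t) / t%:E) (pinfty_nbhs R)
  | g in [set g : R -> R | g 0%R = 0%R /\
      forall x y : R, (0 <= x)%R -> (0 <= y)%R ->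
        (`|g x - g y| <= `|x - y|)%R]].

(** Only arguments in [[0, +oo]] are meaningful. The values are real numbers,
    since [h gamma] is finite and at least [2 / (1 + gamma)] for [gamma] in
    [(-1, 1)]. *)
Definition f (l : \bar R) : \bar R :=
  match l with
  | r%:E =>
      if (r <= 0)%R then 1
      else 1 - ((2 * r / (1 + r) ^+ 2)%:E * h ((r - 1) / (r + 1))
                + (2 * r / (1 + r))%:E)^-1
  | +oo => (2^-1)%:E
  | -oo => 1
  end.

End Densities.

(* Main.v *)
Require Import Defs.
From mathcomp Require Import all_boot all_order all_algebra.
From mathcomp Require Import all_classical all_reals all_analysis.
From mathcomp Require Import finmap zify ring lra.

Set Implicit Arguments.
Unset Strict Implicit.
Unset Printing Implicit Defensive.

Import Order.TTheory GRing.Theory Num.Theory.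

(** Let [lam] be the liminf of [mu H n / n].  For every 1-Lipschitz [g] with
    [g 0 = 0] there is a colouring of [KN] in which no monochromatic copy of [H]
    is denser than the bound that [g] contributes to [f lam].

    The colouring.  Split the vertices into red and blue ones, and imagine that
    they arrive one at a time, [R(x) = (x + g x) / 2] red and
    [B(x) = (x - g x) / 2] blue ones having arrived at time [x].  Every edge
    takes the colour of its endpoint that arrives first.  In a blue copy of
    [H] the red vertices form an independent set, and those that arrive by
    time [x] only have neighbours among the [B(x)] blue vertices arrived by
    then.  As [H] expands independent sets by a factor of about [lam], at most
    about [B(x) / lam] of the first [R(x)] red vertices are in the copy, and at
    least [R(x) - B(x) / lam] are missing from it
    ([copy_density_bound], [monochromatic_copy_bound]).  In the same way a red
    copy misses [B(y) - R(y) / lam] of the first [B(y)] blue vertices.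

    The labelling.  With [gamma = (lam - 1) / (lam + 1)], the number
    [R(x) - B(x) / lam] is [(1 + lam) / (2 lam)] times [gamma x + g x], so
    [x = Gamma_plus t] is the first time at which a blue copy is forced to miss
    [(1 + lam) / (2 lam) t] red vertices, and [y = Gamma_minus t] plays this
    part for the red copies.  The adversary therefore wants the label set [[n]]
    to contain the first [R(x)] red and the first [B(y)] blue vertices, for [t]
    as large as possible.  These pairs grow with [t], so one sequence of colours
    serves all [t] at once ([lattice_path_through_chain]), and [t] is available
    as soon as [n >= R(x) + B(y) = t + (x + y) / (1 + lam)].  If eventually
    [x + y <= M t], this allows [t = n / K] with [K = 1 + M / (1 + lam)], so the
    missing proportion is at least [(1 + lam) / (2 lam K)], which is the
    reciprocal of [2 lam / (1 + lam)^2 M + 2 lam / (1 + lam)]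
    ([ramsey_density_bound]).

    Letting [M] decrease to [h gamma] gives the theorem for finite [lam].  If
    the liminf is infinite, every finite [lam] may be used, with [g = 0] and
    [M = 2 / gamma]; the resulting bounds [1/2 + 1/(2 lam)] tend to [1/2]. *)

Local Open Scope classical_set_scope.
Local Open Scope card_scope.

(** * Ranks in a set of positive integers *)

Implicit Types P : pred nat.

Definition cnt (P : pred nat) (n : nat) : nat := count P (iota 1 n).

Lemma cntS P n : cnt P n.+1 = (cnt P n + P n.+1)%N.
Proof. by rewrite /cnt -{1}[n.+1]addn1 iotaD count_cat /= addn0 add1n. Qed.

Lemma cnt_predC P n : (cnt P n + cnt (predC P) n)%N = n.
Proof. by rewrite /cnt count_predC size_iota. Qed.

Lemma cnt_mono P m n : (m <= n)%N -> (cnt P m <= cnt P n)%N.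
Proof. by move=> mn; rewrite -(subnKC mn) /cnt iotaD count_cat leq_addr. Qed.

Lemma cnt_gt0 P k : (0 < k)%N -> P k -> (0 < cnt P k)%N.
Proof. by case: k => // k _ Pk; rewrite cntS Pk addn1. Qed.

Lemma cnt_inj P j k : P j -> P k -> cnt P j = cnt P k -> j = k.
Proof.
wlog: j k / (j < k)%N.
  move=> th; case: (ltngtP j k) => // jk Pj Pk e; first exact: (th _ _ jk).
  by symmetry; apply: (th _ _ jk).
case: k => // k; rewrite ltnS => jk _ Pk.
by have := cnt_mono P jk; rewrite cntS Pk; lia.
Qed.

Lemma cnt_rank_le P i n :
  cnt (fun k => P k && (cnt P k <= i)%N) n = minn i (cnt P n).
Proof.
elim: n => [|n IHn]; first by rewrite /cnt /= minn0.
rewrite cntS IHn (cntS P n); case: (P n.+1) => /=; last by rewrite !addn0.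
by case: leqP; lia.
Qed.

Lemma card_cnt (P : pred nat) n :
  [set k | P k /\ (1 <= k <= n)%N] #= `I_(cnt P n).
Proof.
have -> : [set k | P k /\ (1 <= k <= n)%N] =
    [set` [fset k in [seq k <- iota 1 n | P k]]%fset].
  apply/seteqP; split=> k /=; rewrite !inE mem_filter mem_iota.
    by case=> -> /=; lia.
  by case/andP=> -> ?; split=> //; lia.
apply/card_eq_fsetP.
by rewrite card_fseq undup_id ?size_filter// filter_uniq ?iota_uniq.
Qed.

(** * Copies of a graph inside the natural numbers *)

Section Copies.
Variables (R : realType) (T : Type) (H : sgraph T) (G : sgraph nat).
Hypothesis isoHG : isomorphic H G.

(** The preimage of [I] in [H] has the same size and its outside neighbours
    inject into [`I_q], so it competes in the infimum defining [mu]. *)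
Lemma mu_le_of_copy (I : set nat) (r q : nat) (f : nat -> nat) :
  independent G I -> I #= `I_r ->
  {in nbrs G I &, injective f} -> {homo f : v / nbrs G I v >-> (v < q)%N} ->
  (mu R H r <= q%:R%:E)%E.
Proof.
case: isoHG => phi [[phiV phiI phiS] phiE] [IG Iind] cI finj fq.
pose J := vert H `&` phi @^-1` I.
have phiJ : phi @` J = I.
  apply/seteqP; split=> [_ [x [_ Ix] <-]//|k Ik].
  by have [x Hx xk] := phiS _ (IG _ Ik); exists x => //; split=> //=; rewrite xk.
have vH x y : adj H x y -> vert H x /\ vert H y.
  by move=> xy; split; [exact: adj_vert xy|exact: adj_vert (adj_sym xy)].
have nV x : nbrs H J x -> vert H x by move=> [[y _] /vH[]].
have nN x : nbrs H J x -> nbrs G I (phi x).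
  move=> [[y [Hy Iy] yx] nJ]; have [_ Hx] := vH _ _ yx; split.
    by exists (phi y) => //; apply/phiE.
  by move=> Ix; apply: nJ.
have cN : nbrs H J #<= `I_q.
  have inj : {in nbrs H J &, injective (f \o phi)}.
    move=> x y /set_mem xN /set_mem yN /= /finj e.
    apply: phiI; [exact/mem_set/nV|exact/mem_set/nV|].
    by apply: e; apply/mem_set/nN.
  rewrite -(card_le_eql (inj_card_eq inj)); apply: subset_card_le.
  by move=> _ [x /nN xN <-]; exact: fq.
have [m cm] : exists m, nbrs H J #= `I_m.
  by apply/finite_setP; apply: card_le_finite cN _; exact: finite_II.
have mq : (m <= q)%N.
  by rewrite -card_le_II -(card_le_eql cm).
apply: ge_ereal_inf; exists (m%:R%:E); last by rewrite lee_fin ler_nat.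
exists m => //; exists J; split=> //.
- split=> [x []//|x y [Hx Ix] [Hy Iy] xy]; apply: (Iind _ _ Ix Iy).
  by apply/phiE.
- rewrite -phiJ in cI; apply: card_eq_trans cI; rewrite card_eq_sym.
  apply: inj_card_eq => x y /set_mem[Hx _] /set_mem[Hy _].
  by apply: phiI; exact: mem_set.
Qed.

(** The vertices satisfying [P] are those of the colour opposite to the copy
    [G], and [cnt P u] is the rank of [u] among them.  The copy uses [r] of the
    first [i] such vertices; these are independent and have at most [q] outside
    neighbours, so the other [i - r] are missing. *)
Lemma copy_density_bound (P : pred nat) (i q n : nat) :
  (forall k, vert G k -> (0 < k)%N) ->
  (forall u v, P u -> P v -> ~ adj G u v) ->
  (forall u v, P u -> ~~ P v -> adj G u v -> (cnt P u <= i)%N ->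
     (cnt (predC P) v <= q)%N) ->
  (i <= cnt P n)%N ->
  exists2 r : nat, (mu R H r <= q%:R%:E)%E &
    (#|` fset_set (vert G `&` [set k | (1 <= k <= n)%N])| <= n - i + r)%N.
Proof.
move=> V0 PP PQ iP.
pose V k := `[< vert G k >].
pose W k := V k && (P k && (cnt P k <= i)%N).
exists (cnt W n).
  pose I := [set k | W k /\ (1 <= k <= n)%N].
  have IP u : I u -> [/\ vert G u, P u & (cnt P u <= i)%N].
    by move=> [/andP[/asboolP Vu /andP[Pu ui]] _].
  have NQ v : nbrs G I v -> [/\ (0 < v)%N, ~~ P v & (cnt (predC P) v <= q)%N].
    move=> [[u /IP[Vu Pu ui] uv] _].
    have v0 : (0 < v)%N by apply: V0; apply: adj_vert (adj_sym uv).
    have nPv : ~~ P v by apply/negP => Pv; exact: PP uv.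
    by split=> //; apply: PQ uv ui.
  apply: (@mu_le_of_copy I _ q (fun v => (cnt (predC P) v).-1)).
  - by split=> [u /IP[]//|u v /IP[_ Pu _] /IP[_ Pv _]]; exact: PP.
  - exact: card_cnt.
  - move=> u v /set_mem/NQ[u0 Pu _] /set_mem/NQ[v0 Pv _] e.
    apply: (@cnt_inj (predC P)) => //.
    have := @cnt_gt0 (predC P) _ u0 Pu; have := @cnt_gt0 (predC P) _ v0 Pv.
    by move: e => /=; lia.
  - by move=> v /NQ[v0 Pv] /=; have := @cnt_gt0 (predC P) _ v0 Pv => /=; lia.
rewrite (_ : vert G `&` _ = [set k | V k /\ (1 <= k <= n)%N]); last first.
  by apply/seteqP; split=> k [] /asboolP.
rewrite (card_fset_set (card_cnt _ _)).
(* Outside [W], the copy lies among the [n - i] vertices of [[n]] that are not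
   of rank at most [i] in [P]. *)
pose Q k := P k && (cnt P k <= i)%N.
have cQ : (cnt Q n + cnt (predC Q) n)%N = n := cnt_predC Q n.
rewrite {1}/Q cnt_rank_le (minn_idPl iP) in cQ.
rewrite -[in (n - i)%N]cQ addKn addnC.
rewrite /cnt -count_predUI; apply: leq_trans (leq_addr _ _).
apply: sub_count => k Vk /=; rewrite /W Vk /= /Q.
by case: (P k && _).
Qed.
End Copies.

(** * Lattice paths through chains *)

(** A chain in [nat * nat] lies on a monotone lattice path with unit steps, read
    here as the predicate [P] telling which steps go right.  The path stays
    comparable with every point of the chain: if both possible steps lost this,
    two points of the chain would be incomparable. *)
Lemma lattice_path_through_chain (S : set (nat * nat)) :
  (forall p q, S p -> S q ->
     (p.1 <= q.1 /\ p.2 <= q.2)%N \/ (q.1 <= p.1 /\ q.2 <= p.2)%N) ->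
  exists P : pred nat, forall p n, S p -> (p.1 + p.2 <= n)%N ->
    (p.1 <= cnt P n)%N /\ (p.2 <= cnt (predC P) n)%N.
Proof.
move=> chain.
pose J a b := forall p, S p ->
  (p.1 <= a /\ p.2 <= b)%N \/ (a <= p.1 /\ b <= p.2)%N.
have J0 : J 0%N 0%N by move=> p _; right.
have step a b : J a b -> ~ J a.+1 b -> J a b.+1.
  move=> Jab /existsNP[p /not_implyP[Sp pJ]] q Sq.
  by have := Jab _ Sp; have := Jab _ Sq; have := chain _ _ Sp Sq; lia.
pose path := fix path n := if n is m.+1 then
    if `[< J (path m).1.+1 (path m).2 >] then ((path m).1.+1, (path m).2)
    else ((path m).1, (path m).2.+1) else (0%N, 0%N).
pose P k := `[< J (path k.-1).1.+1 (path k.-1).2 >].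
have pathP n : [/\ cnt P n = (path n).1, cnt (predC P) n = (path n).2 &
    J (path n).1 (path n).2].
  elim: n => [|n [IH1 IH2 IHJ]]; first by split.
  rewrite !cntS IH1 IH2 /= /P /=.
  by case: asboolP => Jn /=; rewrite ?addn1 ?addn0; split=> //; exact: step.
exists P => p n Sp pn; have [-> -> Jn] := pathP n.
have e : ((path n).1 + (path n).2)%N = n.
  by have [<- <- _] := pathP n; exact: cnt_predC.
by have := Jn _ Sp; lia.
Qed.

Local Open Scope ring_scope.

(** * Expansion of independent sets *)

Section Reals.
Variable R : realType.
Implicit Types (g : R -> R) (x t : R).

(** A liminf of [mu H n / n] at least [lam], stated as the upper bound on the
    size of an independent set that the counting argument uses; in this form an
    infinite liminf gives it for every [lam]. *)
Definition expansion (T : Type) (H : sgraph T) (lam : R) :=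
  forall d : R, 0 < d -> exists r0 : nat, forall r q : nat,
    (mu R H r <= q%:R%:E)%E -> r%:R <= r0%:R + (lam^-1 + d) * q%:R.

Lemma expansion_of_liminf (T : Type) (H : sgraph T) (lam : R) : 0 < lam ->
  (lam%:E <= limn_einf (fun n : nat => mu R H n / n%:R%:E))%E ->
  expansion H lam.
Proof.
move=> lam0 liminf d d0.
have inv0 : 0 < lam^-1 by rewrite invr_gt0.
pose lam' := (lam^-1 + d)^-1.
have lam'0 : 0 < lam' by rewrite invr_gt0; lra.
have lam'lam : lam' < lam.
  rewrite -[ltRHS]invrK ltf_pV2 ?posrE //; lra.
have : (limn_esup (fun n => - (mu R H n / n%:R%:E)) < (- lam')%:E)%E.
  rewrite EFinN lteNr; apply: lt_le_trans liminf; by rewrite lte_fin.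
case/ereal_inf_lt => _ [V [N _ NV] <-] supV.
exists N.+1 => r q mq.
have [rN|Nr] := leqP r N.
  have : r%:R <= N.+1%:R :> R by rewrite ler_nat leqW.
  have : 0 <= (lam^-1 + d) * q%:R by rewrite mulr_ge0 //; lra.
  lra.
have r0 : 0 < r%:R :> R by rewrite ltr0n; case: r Nr mq.
have : (lam'%:E < mu R H r / r%:R%:E)%E.
  rewrite -lteN2; apply: le_lt_trans supV; apply: ereal_sup_ubound.
  by exists r => //; apply: NV => /=; exact: ltnW.
have : (mu R H r / r%:R%:E <= (q%:R / r%:R)%:E)%E.
  by rewrite inver gt_eqF // EFinM; apply: lee_wpmul2r => //.
move=> /[swap] /lt_le_trans /[apply]; rewrite lte_fin ltr_pdivlMr // => lq.
have : r%:R <= (lam^-1 + d) * q%:R.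
  by rewrite mulrC -[_ + d]invrK ler_pdivlMr // mulrC; exact: ltW.
by have : 0 <= N.+1%:R :> R by []; lra.
Qed.

(** * The functions Gamma *)

Definition lip1 g := g 0 = 0 /\
  forall x y, 0 <= x -> 0 <= y -> `|g x - g y| <= `|x - y|.

Lemma lip1N g : lip1 g -> lip1 (fun x => - g x).
Proof.
move=> [g0 gl]; split=> [|x y x0 y0]; first by rewrite g0 oppr0.
by rewrite -opprD normrN; exact: gl.
Qed.

Lemma Gamma_minusN gamma g :
  Gamma_minus gamma g = Gamma_plus gamma (fun x => - g x).
Proof. by []. Qed.

Lemma lip1_le g x y : lip1 g -> 0 <= x -> x <= y ->
  g x - g y <= y - x /\ g y - g x <= y - x.
Proof.
move=> [_ gl] x0 xy; have := gl x y x0 (le_trans x0 xy).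
by rewrite [X in _ <= X]distrC [X in _ <= X]ger0_norm ?subr_ge0 // ler_norml; lra.
Qed.

Lemma le_Gamma_plus gamma g s t : s <= t ->
  (Gamma_plus gamma g s <= Gamma_plus gamma g t)%E.
Proof.
move=> st; apply: ereal_inf_le_tmp => _ [x [x0 xt] <-].
by exists x => //; split => //; exact: le_trans xt.
Qed.

Lemma Gamma_plus_ge0 gamma g t : (0 <= Gamma_plus gamma g t)%E.
Proof. by apply: le_ereal_inf_tmp => _ [x [x0 _] <-]; rewrite lee_fin. Qed.

(** By continuity the infimum is attained, and as [gamma * x + g x] vanishes at
    [0] and [0 < t], it is attained with equality. *)
Lemma Gamma_plus_attained gamma g t : lip1 g -> -1 < gamma < 1 -> 0 < t ->
  (Gamma_plus gamma g t < +oo)%E ->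
  exists x, [/\ Gamma_plus gamma g t = x%:E, 0 <= x & gamma * x + g x = t].
Proof.
move=> lipg /andP[ga gb] t0 fin.
have [x xE] : exists x, Gamma_plus gamma g t = x%:E.
  move: fin (Gamma_plus_ge0 gamma g t).
  by case: (Gamma_plus _ _ _) => // x _ _; exists x.
have x0 : 0 <= x by rewrite -lee_fin -xE Gamma_plus_ge0.
exists x; split=> //; apply/eqP; rewrite eq_le; apply/andP; split.
  rewrite leNgt; apply/negP => tx.
  have xgt0 : 0 < x.
    rewrite lt_neqAle x0 andbT; apply/eqP => x0'.
    by move: tx; rewrite -x0' (proj1 lipg); lra.
  pose e := Num.min x ((gamma * x + g x - t) / 2).
  have [e0 ex et] : [/\ 0 < e, e <= x & e <= (gamma * x + g x - t) / 2].
    by rewrite /e lt_min !ge_min !lexx orbT; split => //; apply/andP; split=> //; lra.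
  have xe0 : 0 <= x - e by lra.
  have xex : x - e <= x by lra.
  have [_ gl] := lip1_le lipg xe0 xex.
  suff : (Gamma_plus gamma g t <= (x - e)%:E)%E by rewrite xE lee_fin; lra.
  apply: ereal_inf_lbound; exists (x - e) => //; split; first lra.
  by nra.
rewrite leNgt; apply/negP => xt.
pose e := (t - (gamma * x + g x)) / 2.
have e0 : 0 < e by rewrite /e; lra.
have : (Gamma_plus gamma g t < (x + e)%:E)%E by rewrite xE lte_fin; lra.
case/ereal_inf_lt => _ [y [y0 ty] <-]; rewrite lte_fin => yxe.
have xy : x <= y.
  by rewrite -lee_fin -xE; apply: ereal_inf_lbound; exists y.
have [_ gl] := lip1_le lipg x0 xy.
by rewrite /e in yxe; nra.
Qed.

(** * Upper density *)

Lemma upper_density_le (S : set nat) (L : R) :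
  (forall e, 0 < e -> exists n0 : nat, forall n, (n0 <= n)%N ->
    #|` fset_set (S `&` [set k | (1 <= k <= n)%N])|%:R <= (L + e) * n%:R) ->
  (upper_density R S <= L%:E)%E.
Proof.
move=> SL; apply/lee_addgt0Pr => e e0; have [n0 n0P] := SL _ e0.
apply: ge_ereal_inf; eexists.
  by exists [set n | (n0.+1 <= n)%N] => //; exact: nbhs_infty_ge.
apply: ub_ereal_sup => _ [n /= n0n <-]; rewrite -EFinD lee_fin.
rewrite ler_pdivrMr ?n0P ?ltr0n //; [exact: ltnW|lia].
Qed.

Lemma upper_density_le1 (S : set nat) : (upper_density R S <= 1)%E.
Proof.
apply: upper_density_le => e e0; exists 0%N => n _.
apply: (@le_trans _ _ n%:R); last by rewrite ler_peMl //; lra.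
rewrite ler_nat.
rewrite (_ : S `&` _ = [set k | `[< S k >] /\ (1 <= k <= n)%N]); last first.
  by apply/seteqP; split=> k [] /asboolP.
rewrite (card_fset_set (card_cnt _ _)).
by rewrite -{2}(cnt_predC (fun k => `[< S k >]) n) leq_addr.
Qed.

(** * The colouring *)

(** Red vertices are those satisfying [P] and [true] is the colour red.
    [pre i j] says that the [i]-th red vertex arrives before the [j]-th blue
    one; the edge between them takes the colour of the earlier one. *)
Definition precedence_coloring (P : pred nat) (pre : nat -> nat -> Prop)
    (u v : nat) : bool :=
  match P u, P v with
  | true, true => true
  | false, false => false
  | true, false => `[< pre (cnt P u) (cnt (predC P) v) >]
  | false, true => `[< pre (cnt P v) (cnt (predC P) u) >]
  end.

Lemma precedence_coloring_sym P pre : symmetric (precedence_coloring P pre).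
Proof. by move=> u v; rewrite /precedence_coloring; case: (P u); case: (P v). Qed.

(** The numbers of red and of blue vertices arrived by time [x]. *)
Definition red g x := (x + g x) / 2.
Definition blue g x := (x - g x) / 2.

(** There is a time [x] by which the [i]-th red vertex has arrived and the [j]-th
    blue one has not.  Stating this with a time rather than with an enumeration
    of the vertices in their order of arrival avoids rounding [red] and [blue]
    to integers. *)
Definition precedes g (i j : nat) :=
  exists x, [/\ 0 <= x, i%:R <= red g x & blue g x < j%:R].

Lemma le_red g x y : lip1 g -> 0 <= x -> x <= y -> red g x <= red g y.
Proof. by move=> lg x0 xy; have := lip1_le lg x0 xy; rewrite /red; lra. Qed.

Lemma le_blue g x y : lip1 g -> 0 <= x -> x <= y -> blue g x <= blue g y.
Proof. by move=> lg x0 xy; have := lip1_le lg x0 xy; rewrite /blue; lra. Qed.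

Lemma red_ge0 g x : lip1 g -> 0 <= x -> 0 <= red g x.
Proof.
by move=> lg x0; have := le_red lg (lexx 0) x0; rewrite {1}/red (proj1 lg); lra.
Qed.

Lemma blue_ge0 g x : lip1 g -> 0 <= x -> 0 <= blue g x.
Proof.
by move=> lg x0; have := le_blue lg (lexx 0) x0; rewrite {1}/blue (proj1 lg); lra.
Qed.

(** The two alternatives are a blue and a red copy.  In a blue copy, a blue
    vertex adjacent to a red one of rank at most [red g x] was not preceded by
    it, hence has rank at most [blue g x]; in a red copy the roles are exchanged,
    by monotonicity of [red] and [blue].  The term [1] pays for truncation. *)
Lemma monochromatic_copy_bound (T : Type) (H : sgraph T) (G : sgraph nat)
    (P : pred nat) g x y (n : nat) :
  lip1 g -> isomorphic H G -> subgraph G KN ->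
  monochromatic (precedence_coloring P (precedes g)) G ->
  0 <= x -> 0 <= y ->
  (Num.truncn (red g x) <= cnt P n)%N ->
  (Num.truncn (blue g y) <= cnt (predC P) n)%N ->
  exists r : nat,
    let size := #|` fset_set (vert G `&` [set k | (1 <= k <= n)%N])|%:R in
    ((mu R H r <= (Num.truncn (blue g x))%:R%:E)%E /\
       size <= n%:R - red g x + 1 + r%:R) \/
    ((mu R H r <= (Num.truncn (red g y))%:R%:E)%E /\
       size <= n%:R - blue g y + 1 + r%:R).
Proof.
move=> lg iso [GV GE] [b mono] x0 y0 xn yn.
have nP Q : cnt (predC (predC Q)) =1 cnt Q.
  by move=> k; apply: eq_count => j /=; rewrite negbK.
have cast (i s r : nat) (z : R) : (i <= n)%N -> (s <= n - i + r)%N ->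
    z < i.+1%:R -> s%:R <= n%:R - z + 1 + r%:R.
  move=> ni; rewrite -(ler_nat R) natrD natrB // -[i.+1]addn1 natrD; lra.
have cn Q : (cnt Q n <= n)%N by rewrite -{2}(cnt_predC Q n) leq_addr.
case: b mono => mono.
- have [|u v|u v Pu|r mr sr] := copy_density_bound R (i := Num.truncn (blue g y))
      (P := predC P) (q := Num.truncn (red g y)) iso _ _ _ yn.
  + by move=> k /GV.
  + by move=> /negbTE Pu /negbTE Pv /mono; rewrite /precedence_coloring Pu Pv.
  + rewrite /= negbK => Pv /mono; rewrite /precedence_coloring (negbTE Pu) Pv.
    move=> /asboolP[z [z0 vz zu]] uy; rewrite nP.
    rewrite truncn_ge_nat ?red_ge0 //; apply: le_trans vz _; apply: le_red => //.
    move: uy; rewrite truncn_ge_nat ?blue_ge0 // => uy.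
    rewrite leNgt; apply/negP => /ltW yz.
    by have := le_blue lg y0 yz; lra.
  + exists r; right; split => //; apply: cast sr _; last exact: truncnS_gt.
    exact: leq_trans yn (cn _).
- have [|u v|u v Pu|r mr sr] := copy_density_bound R (i := Num.truncn (red g x))
      (P := P) (q := Num.truncn (blue g x)) iso _ _ _ xn.
  + by move=> k /GV.
  + by move=> Pu Pv /mono; rewrite /precedence_coloring Pu Pv.
  + move=> /negbTE Pv /mono; rewrite /precedence_coloring Pu Pv => /asboolPn nuv ux.
    rewrite truncn_ge_nat ?blue_ge0 // leNgt; apply/negP => xv.
    apply: nuv; exists x; split => //.
    by rewrite -truncn_ge_nat ?red_ge0.
  + exists r; left; split => //; apply: cast sr _; last exact: truncnS_gt.
    exact: leq_trans xn (cn _).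
Qed.

(** In the blue copy, [u] and [v] are the numbers of red and blue vertices arrived
    at the time in question and [q] is [v] truncated; in the red copy the colours
    are exchanged.  The copy contains [r] of the first [u] vertices of the
    opposite colour.  Half of the error [e * n] pays for the constant [r0 + 1]
    and half for the excess [e / (2 * (M + 1))] over [lam^-1]. *)
Lemma copy_proportion_bound (lam M e t n u v q r r0 : R) :
  0 < lam -> 0 <= M -> 0 < e -> 0 < t -> n = (1 + M / (1 + lam)) * t ->
  r <= r0 + (lam^-1 + e / (2 * (M + 1))) * q -> 2 * (r0 + 1) < e * n ->
  q <= v -> v <= M * t -> lam * u - v = (1 + lam) / 2 * t ->
  n - u + 1 + r <=
    (1 - (2 * lam / (1 + lam) ^+ 2 * M + 2 * lam / (1 + lam))^-1 + e) * n.
Proof.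
move=> lam0 M0 e0 t0 nE rq ne qv vM luv.
have tn : t <= n.
  have M1 : 0 <= M / (1 + lam) by rewrite divr_ge0 //; lra.
  by rewrite nE ler_peMl //; lra.
have missE : (2 * lam / (1 + lam) ^+ 2 * M + 2 * lam / (1 + lam))^-1 * n =
    u - v / lam.
  have -> : u - v / lam = (lam * u - v) / lam by field; lra.
  have pos : 0 < 2 * lam * (1 + lam + M) by rewrite !mulr_gt0 //; lra.
  by rewrite luv nE; field; apply/and3P; split; lra.
have d0 : 0 < e / (2 * (M + 1)) by rewrite divr_gt0 //; lra.
have dM : e / (2 * (M + 1)) * (M * t) <= e / 2 * n.
  have -> : e / 2 * n = e / (2 * (M + 1)) * ((M + 1) * n) by field; lra.
  by rewrite ler_pM2l // ler_pM // ?lerDl // ltW.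
have qb : (lam^-1 + e / (2 * (M + 1))) * q <=
    v / lam + e / (2 * (M + 1)) * (M * t).
  rewrite mulrDl lerD //; first by rewrite mulrC ler_pM2r ?invr_gt0.
  by rewrite ler_pM2l //; exact: le_trans vM.
rewrite mulrDl mulrBl mul1r missE.
by clear -qb dM rq ne; lra.
Qed.

(** The density bound given by a single [g].  The nonnegativity of [M] is part of
    the conclusion because it follows from the bound on the two functions
    Gamma, and rules out a negative value of [h]. *)
Lemma ramsey_density_bound (T : Type) (H : sgraph T) (lam M t0 l : R) g :
  0 < lam -> expansion H lam -> lip1 g -> 0 < t0 ->
  let gamma := (lam - 1) / (lam + 1) in
  (forall t, t0 < t ->
     (Gamma_plus gamma g t + Gamma_minus gamma g t <= (M * t)%:E)%E) ->
  (forall c : nat -> nat -> bool, symmetric c ->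
      exists G : sgraph nat, [/\ subgraph G KN, isomorphic H G,
        monochromatic c G & (l%:E <= upper_density R (vert G))%E]) ->
  0 <= M /\
  l <= 1 - (2 * lam / (1 + lam) ^+ 2 * M + 2 * lam / (1 + lam))^-1.
Proof.
move=> lam0 expH lg t00 gamma GM ramsey.
have lg' := lip1N lg.
have gam : -1 < gamma < 1.
  by rewrite /gamma ltr_pdivrMr ?ltr_pdivlMr; lra.
have fin t : t0 < t -> exists x y, [/\ Gamma_plus gamma g t = x%:E,
    Gamma_minus gamma g t = y%:E, 0 <= x /\ 0 <= y,
    gamma * x + g x = t /\ gamma * y - g y = t & x + y <= M * t].
  move=> tt; have t0' : 0 < t by exact: lt_trans tt.
  have GMt := GM _ tt.
  have P0 : (0 <= Gamma_plus gamma g t)%E := Gamma_plus_ge0 _ _ _.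
  have Q0 : (0 <= Gamma_minus gamma g t)%E := Gamma_plus_ge0 _ (fun x => - g x) _.
  have [x [xE x0 gx]] : exists x,
      [/\ Gamma_plus gamma g t = x%:E, 0 <= x & gamma * x + g x = t].
    apply: Gamma_plus_attained => //.
    by apply: le_lt_trans (ltry (M * t)); apply: le_trans GMt; rewrite leeDl.
  have [y [yE y0 gy]] : exists y,
      [/\ Gamma_minus gamma g t = y%:E, 0 <= y & gamma * y - g y = t].
    apply: (Gamma_plus_attained lg') => //.
    by apply: le_lt_trans (ltry (M * t)); apply: le_trans GMt; rewrite leeDr.
  by exists x, y; split=> //; rewrite -lee_fin EFinD -xE -yE.
pose X t := fine (Gamma_plus gamma g t).
pose Y t := fine (Gamma_minus gamma g t).
have XY t : t0 < t -> [/\ 0 <= X t, 0 <= Y t, gamma * X t + g (X t) = t,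
    gamma * Y t - g (Y t) = t & X t + Y t <= M * t].
  by move=> /fin[x [y [xE yE [? ?] [? ?] ?]]]; rewrite /X /Y xE yE.
have Xmono s t : t0 < s -> s <= t -> X s <= X t.
  move=> s0 st; have := le_Gamma_plus gamma g st; rewrite /X.
  have [x [y [-> _ _ _ _]]] := fin _ s0.
  by have [x' [y' [-> _ _ _ _]]] := fin _ (lt_le_trans s0 st).
have Ymono s t : t0 < s -> s <= t -> Y s <= Y t.
  move=> s0 st; have := le_Gamma_plus gamma (fun x => - g x) st.
  rewrite -Gamma_minusN /Y.
  have [x [y [_ -> _ _ _]]] := fin _ s0.
  by have [x' [y' [_ -> _ _ _]]] := fin _ (lt_le_trans s0 st).
have M0 : 0 <= M.
  have t1 : t0 < t0 + 1 by lra.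
  have [? ? _ _ ?] := XY _ t1.
  by rewrite -(pmulr_lge0 M (x := t0 + 1)); lra.
split=> //.
(* For every [t], the sizes of the initial segments of red and of blue vertices
   which [[n]] has to contain. *)
pose S := [set p : nat * nat | exists2 t, t0 < t &
  p = (Num.truncn (red g (X t)), Num.truncn (blue g (Y t)))].
have [P PS] : exists P : pred nat, forall p n, S p -> (p.1 + p.2 <= n)%N ->
    (p.1 <= cnt P n)%N /\ (p.2 <= cnt (predC P) n)%N.
  apply: lattice_path_through_chain => p q [s s0 ->] [t tt0 ->] /=.
  have [Xs0 Ys0 _ _ _] := XY _ s0; have [Xt0 Yt0 _ _ _] := XY _ tt0.
  by case: (lerP s t) => [st|/ltW ts]; [left|right];
    split; apply: le_truncn; (apply: le_red || apply: le_blue) => //;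
    (apply: Xmono || apply: Ymono).
have [G [sub iso mono lG]] := ramsey _ (precedence_coloring_sym P (precedes g)).
rewrite -lee_fin; apply: le_trans lG _; apply: upper_density_le => e e0.
pose K := 1 + M / (1 + lam).
have K1 : 1 <= K by rewrite lerDl divr_ge0 //; lra.
pose d := e / (2 * (M + 1)).
have d0 : 0 < d by rewrite divr_gt0 //; lra.
have [r0 r0P] := expH _ d0.
exists (maxn (Num.truncn (K * t0)).+1 (Num.truncn (2 * (r0.+1)%:R / e)).+1) => n.
rewrite geq_max => /andP[nK ne].
have {}nK : K * t0 < n%:R.
  by apply: lt_le_trans (truncnS_gt _) _; rewrite ler_nat.
have {}ne : 2 * (r0.+1)%:R < e * n%:R.
  rewrite [e * _]mulrC -ltr_pdivrMr //.
  by apply: lt_le_trans (truncnS_gt _) _; rewrite ler_nat.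
(* The initial segments for this [t] have total size at most [K * t = n]. *)
pose t := n%:R / K.
have nE : n%:R = K * t by rewrite /t mulrC divfK //; lra.
have tt0 : t0 < t by rewrite /t ltr_pdivlMr ?[t0 * K]mulrC //; lra.
have [Xt0 Yt0 Xt Yt XYt] := XY _ tt0.
have tn : 0 < t by lra.
set x := X t in Xt0 Xt XYt; set y := Y t in Yt0 Yt XYt.
have lam1 : 1 + lam != 0 by lra.
have lam1' : lam + 1 != 0 by lra.
have redE : red g x = t / 2 + x / (1 + lam).
  have -> : red g x = (x + (t - gamma * x)) / 2 by rewrite /red; lra.
  by rewrite /gamma; field; lra.
have blueE : blue g y = t / 2 + y / (1 + lam).
  have -> : blue g y = (y + (t - gamma * y)) / 2 by rewrite /blue; lra.
  by rewrite /gamma; field; lra.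
have Sn : (Num.truncn (red g x) + Num.truncn (blue g y) <= n)%N.
  rewrite -(ler_nat R) natrD.
  have a1 : (Num.truncn (red g x))%:R <= red g x by rewrite truncn_le red_ge0.
  have a2 : (Num.truncn (blue g y))%:R <= blue g y by rewrite truncn_le blue_ge0.
  apply: le_trans (lerD a1 a2) _; rewrite redE blueE nE /K.
  rewrite [leLHS](_ : _ = t + (x + y) / (1 + lam)); last by field.
  rewrite [leRHS]mulrDl mul1r lerD2l [leRHS]mulrAC ler_pM2r ?invr_gt0 //; lra.
have [|xn yn] := PS (_, _) n _ Sn; first by exists t.
have [r /= cases] := monochromatic_copy_bound lg iso sub mono Xt0 Yt0 xn yn.
have vx : blue g x <= x.
  by have := red_ge0 lg Xt0; rewrite /red /blue; lra.
have vy : red g y <= y.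
  by have := blue_ge0 lg Yt0; rewrite /red /blue; lra.
rewrite -[r0.+1]addn1 natrD in ne.
case: cases => -[/r0P rq sr]; apply: le_trans sr _.
- apply: copy_proportion_bound lam0 M0 e0 tn nE rq ne _ (le_trans vx _) _.
  + by rewrite truncn_le blue_ge0.
  + lra.
  + by rewrite /blue /red -[in RHS]Xt /gamma; field; lra.
- apply: copy_proportion_bound lam0 M0 e0 tn nE rq ne _ (le_trans vy _) _.
  + by rewrite truncn_le red_ge0.
  + lra.
  + by rewrite /blue /red -[in RHS]Yt /gamma; field; lra.
Qed.

(** * Optimising over the function g *)

Lemma eventual_Gamma_bound gamma (M : R) : (h gamma < M%:E)%E ->
  exists g t0, [/\ lip1 g, 0 < t0 & forall t, t0 < t ->
    (Gamma_plus gamma g t + Gamma_minus gamma g t <= (M * t)%:E)%E].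
Proof.
case/ereal_inf_lt => _ [g lg <-] /ereal_inf_lt[_ [V [t0 [_ t0V]] <-]] supV.
exists g, (Num.max t0 1); split=> //; first by rewrite lt_max ltr01 orbT.
move=> t; rewrite gt_max => /andP[tt0 t1].
have t_gt0 : 0 < t by lra.
rewrite EFinM -lee_pdivrMr //; apply: ltW; apply: le_lt_trans supV.
apply: ereal_sup_ubound; exists t; first exact: t0V.
by rewrite inver gt_eqF.
Qed.

Lemma lip1_zero : lip1 (fun=> 0 : R).
Proof. by split=> // x y _ _; rewrite subrr normr0. Qed.

Lemma Gamma_zero_le gamma t : 0 < gamma -> 0 <= t ->
  (Gamma_plus gamma (fun=> 0%R) t <= (t / gamma)%:E)%E.
Proof.
move=> g0 t0; apply: ereal_inf_lbound; exists (t / gamma) => //; split.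
  by rewrite divr_ge0 // ltW.
by rewrite addr0 mulrC divfK // gt_eqF.
Qed.

(** Continuity of the bound in [M], from the right. *)
Lemma le_of_right_bounds (c d m l : R) : 0 < c -> 0 < d -> l <= 1 ->
  (forall M, m < M -> 0 <= M /\ l <= 1 - (c * M + d)^-1) ->
  0 <= m /\ l <= 1 - (c * m + d)^-1.
Proof.
move=> c0 d0 l1 bound.
have m0 : 0 <= m.
  by apply/ler_addgt0Pr => e e0; apply: (bound _ _).1; lra.
have cm0 : 0 <= c * m by rewrite mulr_ge0 // ltW.
split=> //; suff : 1 <= (1 - l) * (c * m + d).
  by rewrite -ler_pdivrMr ?div1r; lra.
apply/ler_addgt0Pr => e e0.
(* Chosen so that [(1 - l) * e' <= e]; adding [1] to [1 - l] keeps the denominator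
   positive when [l = 1]. *)
pose e' := e / (2 - l).
have e'0 : 0 < e' by rewrite divr_gt0 //; lra.
have [|_] := bound (m + e' / c); first by rewrite ltrDl divr_gt0.
have -> : c * (m + e' / c) + d = c * m + d + e' by field; lra.
have pos : 0 < c * m + d + e' by lra.
rewrite lerBrDr -lerBrDl -[leLHS]mul1r ler_pdivrMr // => lM.
have -> : e = (2 - l) * e' by rewrite /e'; field; lra.
nra.
Qed.

Lemma le_half_of_bounds (l : R) :
  (forall lam, 1 < lam -> l <= 2^-1 + (2 * lam)^-1) -> l <= 2^-1.
Proof.
move=> bound; apply/ler_addgt0Pr => e e0.
have ei0 : 0 < e^-1 by rewrite invr_gt0.
have /bound : 1 < 1 + e^-1 by lra.
move=> /le_trans; apply; rewrite lerD2l.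
by rewrite -[leRHS]invrK lef_pV2 ?posrE; lra.
Qed.

(** The case [g = 0], in which both functions Gamma are at most [t / gamma]. *)
Lemma strong_expansion_bound (T : Type) (H : sgraph T) (lam l : R) :
  1 < lam -> expansion H lam ->
  (forall c : nat -> nat -> bool, symmetric c ->
      exists G : sgraph nat, [/\ subgraph G KN, isomorphic H G,
        monochromatic c G & (l%:E <= upper_density R (vert G))%E]) ->
  l <= 2^-1 + (2 * lam)^-1.
Proof.
move=> lam1 expH ramsey; have lam0 : 0 < lam by lra.
pose gamma := (lam - 1) / (lam + 1).
have gamma0 : 0 < gamma by rewrite divr_gt0 //; lra.
have [t tt|_] := @ramsey_density_bound _ _ lam (2 / gamma)%R 1 l (fun=> 0)
      lam0 expH lip1_zero ltr01 _ ramsey.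
  have t0 : 0 <= t by lra.
  rewrite (_ : 2 / gamma * t = t / gamma + t / gamma); last by field; lra.
  rewrite EFinD; apply: leeD; first exact: Gamma_zero_le.
  rewrite Gamma_minusN (_ : (fun _ => - _) = (fun=> 0)); first exact: Gamma_zero_le.
  by apply/funext => x; rewrite oppr0.
move=> /le_trans; apply; rewrite le_eqVlt; apply/orP; left; apply/eqP.
have pos : 0 < lam * ((lam + 1) * (lam + 1)) by rewrite !mulr_gt0 //; lra.
by rewrite /gamma; field; apply/and4P; split; lra.
Qed.

End Reals.

Local Open Scope ereal_scope.

Theorem theorem3 (R : realType) (T : Type) (H : sgraph T) :
  locally_finite H -> countably_infinite H ->
  ramsey_upper_density R H <=
    f (limn_einf (fun n : nat => mu R H n / n%:R%:E)).
Proof.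
move=> _ _; apply: ub_ereal_sup => _ [l ramsey <-].
have l1E : l%:E <= 1.
  have [G [_ _ _ lG]] := ramsey (fun _ _ => true) (fun _ _ => erefl).
  exact: le_trans lG (upper_density_le1 _ _).
have l1 : (l <= 1)%R by rewrite -lee_fin.
case limE : limn_einf => [lam| |] /=; last exact: l1E.
- case: (leP lam 0%R) => [_|lam0]; first exact: l1E.
  have expH : expansion H lam by apply: expansion_of_liminf; rewrite ?limE.
  set c := (2 * lam / (1 + lam) ^+ 2)%R; set d := (2 * lam / (1 + lam))%R.
  have c0 : (0 < c)%R by rewrite divr_gt0 ?exprn_gt0 ?mulr_gt0 //; lra.
  have d0 : (0 < d)%R by rewrite divr_gt0 ?mulr_gt0 //; lra.
  have bound M : h ((lam - 1) / (lam + 1)) < M%:E ->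
      (0 <= M)%R /\ (l <= 1 - (c * M + d)^-1)%R.
    move=> /eventual_Gamma_bound[g [t0 [lg t00 GM]]].
    exact: (ramsey_density_bound lam0 expH lg t00 GM ramsey).
  case hE : h => [m| |].
  + rewrite hE in bound.
    have [|m0 lm] := le_of_right_bounds c0 d0 l1 (m := m).
      by move=> M mM; apply: bound; rewrite lte_fin.
    rewrite -EFinM -EFinD inver gt_eqF; first by rewrite -EFinN lee_fin.
    by rewrite ltr_wpDl // mulr_ge0 // ltW.
  (* An infinite [h] makes the bound equal to [1]. *)
  + by rewrite gt0_muley ?lte_fin // addye // invey sube0; exact: l1E.
  (* Values of [h] below [0] are excluded by the nonnegativity of [M]. *)
  + have [|] := bound (-1)%R; first by rewrite hE ltNyr.
    by rewrite ler0N1.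
- rewrite lee_fin.
  apply: le_half_of_bounds => lam lam1.
  have lam0 : (0 < lam)%R by exact: lt_trans lam1.
  apply: strong_expansion_bound lam1 _ ramsey.
  by apply: expansion_of_liminf; rewrite ?limE ?leey.
Qed.
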